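(* Let $A$ be a ring, $S=A[\underline{t};\sigma,\underline{\delta}]$ a multivariate Ore extension in $n$ variables, $f,g\in S$, $\underline{a}\in A^n$ and $x\in A$. (1) We have $(fg)(\underline{a})=f(T_{\underline{a}})(g(\underline{a}))$. In particular, if $g(\underline{t})=x\in A$, then $(fx)(\underline{a})=f(T_{\underline{a}})(x)$. (2) If $0\neq g(\underline{a})\in U(A)$, where $U(A)$ is the group of units of $A$, then $(fg)(\underline{a})=f(\underline{a}^{g(\underline{a})})\,g(\underline{a})$.
   Context: All rings are associative with identity, and ring homomorphisms preserve the identity. Let $A$ be a ring, $n\ge 1$, $\sigma:A\to M_n(A)$ a ring homomorphism, and write $\sigma_{ij}(a)$ for the $(i,j)$ entry of $\sigma(a)$. Let $\underline{\delta}=(\delta_1,\dots,\delta_n)^t$ be a column of additive maps $A\to A$ forming a $\sigma$-derivation: $\delta_i(ab)=\sum_{j=1}^n\sigma_{ij}(a)\delta_j(b)+\delta_i(a)b$ for all $a,b\in A$, $1\le i\le n$. The multivariate Ore extension $S=A[\underline{t};\sigma,\underline{\delta}]$ is the ring of (finite) sums $\sum_{m\in M}\alpha_m m$, $\alpha_m\in A$, where $M$ is the free monoid on the variables $t_1,\dots,t_n$ (so $S$ is a free left $A$-module with basis $M$), with multiplication determined by concatenation in $M$ and the rules $t_ia=\sum_{j=1}^n\sigma_{ij}(a)t_j+\delta_i(a)$ for $a\in A$, $1\le i\le n$. Evaluation: for $\underline{a}=(a_1,\dots,a_n)^t\in A^n$ let $I=S(t_1-a_1)+\cdots+S(t_n-a_n)$,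 a left ideal of $S$. Every class in $S/I$ is represented by a unique element of $A$; the evaluation $f(\underline{a})$ is the element of $A$ representing $f(\underline{t})+I$. The map $T_{\underline{a}}$: $T_{\underline{a}}=(T_{a_1},\dots,T_{a_n})^t$, where $T_{a_i}:A\to A$ is the additive map $T_{a_i}(b)=\sum_{j=1}^n\sigma_{ij}(b)a_j+\delta_i(b)$. For $f=\sum_m\alpha_m m\in S$, $f(T_{\underline{a}})\in \mathrm{End}(A,+)$ is obtained by replacing each $t_i$ by $T_{a_i}$ (words become compositions) and each coefficient $\alpha$ by left multiplication by $\alpha$ on $A$. Conjugation: for $x\in U(A)$ and a column $\underline{a}\in A^n$, $\underline{a}^x=\sigma(x)\underline{a}x^{-1}+\underline{\delta}(x)x^{-1}\in A^n$, where $\underline{\delta}(x)=(\delta_1(x),\dots,\delta_n(x))^t$. *)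

(* Defs.v *)
From HB Require Import structures.
From mathcomp Require Import all_boot all_algebra finmap.
From mathcomp.multinomials Require Import monalg.
From mathcomp.classical Require Import boolp.

Set Implicit Arguments.
Unset Strict Implicit.
Unset Printing Implicit Defensive.

Import GRing.Theory.
Local Open Scope ring_scope.

(* Rings are [pzRingType]s: associative with identity, 0 = 1 not excluded. *)

Record sigma_derivation (A : pzRingType) (n : nat)
    (sigma : {rmorphism A -> 'M[A]_n}) := SigmaDerivation {
  sder :> 'I_n -> {additive A -> A};
  sderM : forall (i : 'I_n) (a b : A),
    sder i (a * b) = \sum_(j < n) sigma a i j * sder j b + sder i a * b }.

Section FiniteSums.
Variables (K : choiceType) (G V : zmodType) (phi : K -> {additive G -> V}).

Definition mext (f : {malg G[K]}) : V := \sum_(m <- msupp f) phi m f@_m.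

Lemma mextw (f : {malg G[K]}) (d : {fset K}) :
  fsubset (msupp f) d -> mext f = \sum_(m <- d) phi m f@_m.
Proof.
move=> le_fd; rewrite /mext; apply/big_fset_incl => // m _ /mcoeff_outdom ->.
by rewrite raddf0.
Qed.

Fact mext_is_additive : zmod_morphism mext.
Proof.
move=> f g; have le_fg := msuppB_le f g.
rewrite (mextw le_fg) (mextw (fsubsetUl _ (msupp g))).
rewrite (mextw (fsubsetUr (msupp f) _)) -sumrB; apply: eq_bigr => m _.
by rewrite mcoeffB raddfB.
Qed.
HB.instance Definition _ :=
  GRing.isZmodMorphism.Build {malg G[K]} V mext mext_is_additive.

Lemma mextU (c : G) (m : K) : mext << c *g m >> = phi m c.
Proof. by rewrite (mextw msuppU_le) big_seq_fset1 mcoeffUU. Qed.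
End FiniteSums.

Lemma malg_additive_ext (K : choiceType) (G V : zmodType)
    (u v : {additive {malg G[K]} -> V}) :
  (forall c m, u << c *g m >> = v << c *g m >>) -> u =1 v.
Proof.
move=> uv f; rewrite (monalgE f) !raddf_sum.
by apply: eq_bigr => m _; apply: uv.
Qed.

(* The multivariate Ore extension A[t; sigma, delta], carried by the free left
   A-module on the words in 'I_n. Its product, which depends on sigma and delta,
   is [ore_mul] below; [ore_extE], [oreX_prodE] and [oreX_mulC] recover the
   usual presentation. *)
Definition ore_ext (A : pzRingType) (n : nat)
    (sigma : {rmorphism A -> 'M[A]_n}) (delta : sigma_derivation sigma) : Type :=
  {malg A[seq 'I_n]}.

Section Actions.
Variables (A : pzRingType) (n : nat) (sigma : {rmorphism A -> 'M[A]_n}).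
Variable (delta : sigma_derivation sigma).

(* Formal sums \sum_m f_m (m . v), where the words m are read as compositions
   of the maps T_i (the head of the word is applied last) and the scalars act
   through L. *)
Definition formal_act (V : zmodType) (L : A -> V -> V) (T : 'I_n -> V -> V)
    (f : {malg A[seq 'I_n]}) (v : V) : V :=
  \sum_(m <- msupp f) L f@_m (foldr T v m).

Section Theory.
Variables (V : zmodType) (L : A -> V -> V) (T : 'I_n -> V -> V).
Hypothesis LDl : forall v, zmod_morphism (fun c => L c v).
Hypothesis LDr : forall c, zmod_morphism (L c).
Hypothesis TD : forall i, zmod_morphism (T i).

Let Lc v : {additive A -> V} := HB.pack (fun c => L c v)
  (GRing.isZmodMorphism.Build A V (fun c => L c v) (LDl v)).

Lemma formal_actU c m v : formal_act L T << c *g m >> v = L c (foldr T v m).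
Proof. exact: (mextU (fun m => Lc (foldr T v m))). Qed.

Lemma formal_actDl v : zmod_morphism (fun f => formal_act L T f v).
Proof. exact: (mext_is_additive (fun m => Lc (foldr T v m))). Qed.

Lemma foldr_is_additive m : zmod_morphism (fun v => foldr T v m).
Proof. by elim: m => [|i m IHm] u v //=; rewrite IHm TD. Qed.

Lemma formal_actDr f : zmod_morphism (formal_act L T f).
Proof.
move=> u v; rewrite /formal_act -sumrB; apply: eq_bigr => m _.
by rewrite foldr_is_additive LDr.
Qed.
End Theory.

Definition oreZ (c : A) (g : {malg A[seq 'I_n]}) : {malg A[seq 'I_n]} :=
  \sum_(m <- msupp g) << c * g@_m *g m >>.

(* Left multiplication by t_i, using the rule
   t_i c = \sum_j sigma_ij(c) t_j + delta_i(c). *)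
Definition oreT (i : 'I_n) (g : {malg A[seq 'I_n]}) : {malg A[seq 'I_n]} :=
  \sum_(m <- msupp g)
     (\sum_(j < n) << sigma g@_m i j *g j :: m >> + << delta i g@_m *g m >>).

Fact oreZ_coeff_subproof c (m : seq 'I_n) :
  zmod_morphism (fun d : A => (<< c * d *g m >> : {malg A[seq 'I_n]})).
Proof. by move=> d e; rewrite mulrBr raddfB. Qed.
Let oreZ_coeff c (m : seq 'I_n) : {additive A -> {malg A[seq 'I_n]}} :=
  HB.pack (fun d : A => (<< c * d *g m >> : {malg A[seq 'I_n]}))
   (GRing.isZmodMorphism.Build A {malg A[seq 'I_n]} _
      (oreZ_coeff_subproof c m)).

Fact oreT_coeff_subproof i (m : seq 'I_n) :
  zmod_morphism (fun d : A => (\sum_(j < n) << sigma d i j *g j :: m >>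
     + << delta i d *g m >> : {malg A[seq 'I_n]})).
Proof.
move=> d e; rewrite !raddfB /= opprD addrACA; congr (_ + _).
by rewrite -sumrB; apply: eq_bigr => j _; rewrite !mxE raddfB.
Qed.
Let oreT_coeff i (m : seq 'I_n) : {additive A -> {malg A[seq 'I_n]}} :=
  HB.pack (fun d : A => (\sum_(j < n) << sigma d i j *g j :: m >>
     + << delta i d *g m >> : {malg A[seq 'I_n]}))
   (GRing.isZmodMorphism.Build A {malg A[seq 'I_n]} _
      (oreT_coeff_subproof i m)).

Lemma oreZU c d m : oreZ c << d *g m >> = << c * d *g m >>.
Proof. exact: (mextU (oreZ_coeff c)). Qed.

Lemma oreZDr c : zmod_morphism (oreZ c).
Proof. exact: (mext_is_additive (oreZ_coeff c)). Qed.

Lemma oreTU i c m : oreT i << c *g m >> =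
  \sum_(j < n) << sigma c i j *g j :: m >> + << delta i c *g m >>.
Proof. exact: (mextU (oreT_coeff i)). Qed.

Lemma oreTD i : zmod_morphism (oreT i).
Proof. exact: (mext_is_additive (oreT_coeff i)). Qed.

HB.instance Definition _ c :=
  GRing.isZmodMorphism.Build _ _ (oreZ c) (oreZDr c).
HB.instance Definition _ i :=
  GRing.isZmodMorphism.Build _ _ (oreT i) (oreTD i).

Lemma oreZDl g : zmod_morphism (fun c => oreZ c g).
Proof.
move=> c d; rewrite /oreZ -sumrB; apply: eq_bigr => m _.
by rewrite mulrBl raddfB.
Qed.

Lemma oreZZ c d g : oreZ (c * d) g = oreZ c (oreZ d g).
Proof.
pose u : {additive _ -> _} := (oreZ c \o oreZ d).
apply: (@malg_additive_ext _ _ _ (oreZ (c * d)) u) => e m.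
by rewrite /u /= !oreZU mulrA.
Qed.

Lemma oreZ1 g : oreZ 1 g = g.
Proof.
by apply: (@malg_additive_ext _ _ _ (oreZ 1) idfun) => e m; rewrite /= oreZU mul1r.
Qed.

Lemma sder1 i : delta i 1 = 0.
Proof.
have /esym := sderM delta i 1 1; rewrite rmorph1 !mulr1.
rewrite (bigD1 i) //= big1 => [|j /negPf ij]; last by rewrite mxE eq_sym ij mul0r.
by rewrite mxE eqxx mul1r addr0 => /eqP; rewrite -subr_eq0 addrK => /eqP.
Qed.

Section Composition.
Variables (V : zmodType) (L : A -> V -> V) (T : 'I_n -> V -> V).
Hypothesis LDl : forall v, zmod_morphism (fun c => L c v).
Hypothesis LDr : forall c, zmod_morphism (L c).
Hypothesis TD : forall i, zmod_morphism (T i).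
Hypothesis LM : forall c d v, L (c * d) v = L c (L d v).
Hypothesis TL : forall i c v,
  T i (L c v) = \sum_(j < n) L (sigma c i j) (T j v) + L (delta i c) v.

Let actl v : {additive {malg A[seq 'I_n]} -> V} :=
  HB.pack (fun f => formal_act L T f v)
    (GRing.isZmodMorphism.Build {malg A[seq 'I_n]} V _
       (formal_actDl T LDl v)).
Let La c : {additive V -> V} := HB.pack (L c)
  (GRing.isZmodMorphism.Build V V (L c) (LDr c)).
Let Ta i : {additive V -> V} := HB.pack (T i)
  (GRing.isZmodMorphism.Build V V (T i) (TD i)).

Lemma formal_act_oreZ c g v :
  formal_act L T (oreZ c g) v = L c (formal_act L T g v).
Proof.
pose u : {additive _ -> _} := (actl v \o oreZ c).
pose w : {additive _ -> _} := (La c \o actl v).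
apply: (@malg_additive_ext _ _ _ u w) => d m.
by rewrite /u /w /= oreZU !formal_actU // LM.
Qed.

Lemma formal_act_oreT i g v :
  formal_act L T (oreT i g) v = T i (formal_act L T g v).
Proof.
pose u : {additive _ -> _} := (actl v \o oreT i).
pose w : {additive _ -> _} := (Ta i \o actl v).
apply: (@malg_additive_ext _ _ _ u w) => d m.
rewrite /u /w [LHS]/= oreTU -[LHS]/(actl v _) raddfD raddf_sum /=.
rewrite !formal_actU // TL; congr (_ + _).
by apply: eq_bigr => j _; rewrite formal_actU.
Qed.

Lemma formal_act_comp f g v :
  formal_act L T (formal_act oreZ oreT f g) v =
  formal_act L T f (formal_act L T g v).
Proof.
rewrite {1}/formal_act -[LHS]/(actl v _) {1}/formal_act raddf_sum.
apply: eq_bigr => m _ /=; rewrite formal_act_oreZ; congr (L _ _).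
by elim: m => //= i m <-; rewrite formal_act_oreT.
Qed.
End Composition.

Lemma oreT_oreZ i c g :
  oreT i (oreZ c g) =
  \sum_(j < n) oreZ (sigma c i j) (oreT j g) + oreZ (delta i c) g.
Proof.
have wD : zmod_morphism (fun g => \sum_(j < n) oreZ (sigma c i j) (oreT j g)
    + oreZ (delta i c) g).
  move=> g1 g2; rewrite raddfB opprD addrACA; congr (_ + _).
  by rewrite -sumrB; apply: eq_bigr => j _; rewrite !raddfB.
pose w : {additive {malg A[seq 'I_n]} -> {malg A[seq 'I_n]}} :=
  HB.pack (fun g => \sum_(j < n) oreZ (sigma c i j) (oreT j g)
    + oreZ (delta i c) g) (GRing.isZmodMorphism.Build _ _ _ wD).
pose u : {additive _ -> _} := (oreT i \o oreZ c).
apply: (@malg_additive_ext _ _ _ u w) => d m.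
rewrite /u /w /= !oreZU oreTU sderM raddfD addrA; congr (_ + _).
rewrite raddf_sum rmorphM.
under [in RHS]eq_bigr => j _ do
  rewrite oreTU raddfD raddf_sum /= oreZU.
rewrite [in RHS]big_split /=; congr (_ + _).
rewrite exchange_big /=; apply: eq_bigr => j _.
rewrite mxE raddf_sum /=; apply: eq_bigr => k _.
by rewrite oreZU.
Qed.

Lemma oreT1 i (m : seq 'I_n) : oreT i << 1 *g m >> = << 1 *g i :: m >>.
Proof.
rewrite oreTU sder1 raddf0 addr0 rmorph1 (bigD1 i) //=.
rewrite big1 => [|j /negPf ij]; first by rewrite mxE eqxx addr0.
by rewrite mxE eq_sym ij raddf0.
Qed.

Lemma foldr_oreT1 (m m' : seq 'I_n) :
  foldr oreT << 1 *g m' >> m = << 1 *g m ++ m' >>.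
Proof. by elim: m => //= i m ->; rewrite oreT1. Qed.

Local Notation ore_ext := (ore_ext delta).

HB.instance Definition _ := GRing.Zmodule.on ore_ext.

Definition ore_mul (f g : ore_ext) : ore_ext := formal_act oreZ oreT f g.
Definition ore_one : ore_ext := << 1 *g [::] >>.

Fact ore_mulA : associative ore_mul.
Proof.
move=> f g h; apply/esym/formal_act_comp; first exact: oreZDl.
- exact: oreZDr.
- exact: oreTD.
- exact: oreZZ.
- exact: oreT_oreZ.
Qed.

Fact ore_mul1 : left_id ore_one ore_mul.
Proof.
by move=> f; rewrite /ore_mul formal_actU ?oreZ1 //; apply: oreZDl.
Qed.

Fact ore_mulr1 : right_id ore_one ore_mul.
Proof.
move=> f; rewrite [RHS](monalgE f); apply: eq_bigr => m _.
by rewrite foldr_oreT1 oreZU mulr1 cats0.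
Qed.

Fact ore_mulDl : left_distributive ore_mul +%R.
Proof.
move=> f g h; pose u : {additive _ -> _} := HB.pack (fun f => ore_mul f h)
  (GRing.isZmodMorphism.Build ore_ext ore_ext _ (formal_actDl _ oreZDl h)).
exact: (raddfD u).
Qed.

Fact ore_mulDr : right_distributive ore_mul +%R.
Proof.
move=> f g h; pose u : {additive _ -> _} := HB.pack (ore_mul f)
  (GRing.isZmodMorphism.Build ore_ext ore_ext _ (formal_actDr oreZDr oreTD f)).
exact: (raddfD u).
Qed.

HB.instance Definition _ := GRing.Zmodule_isPzRing.Build ore_ext
  ore_mulA ore_mul1 ore_mulr1 ore_mulDl ore_mulDr.

Definition oreC (c : A) : ore_ext := << c *g [::] >>.
Definition oreX (i : 'I_n) : ore_ext := << 1 *g [:: i] >>.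

Fact oreC_is_additive : zmod_morphism oreC.
Proof. by move=> c d; rewrite /oreC raddfB. Qed.

Lemma ore_mulU c m (g : ore_ext) :
  (<< c *g m >> : ore_ext) * g = oreZ c (foldr oreT g m).
Proof. by rewrite [LHS]formal_actU //; apply: oreZDl. Qed.

Fact oreC_is_monoid_morphism : monoid_morphism oreC.
Proof. by split=> // c d; rewrite ore_mulU /= oreZU. Qed.

HB.instance Definition _ :=
  GRing.isZmodMorphism.Build A ore_ext oreC oreC_is_additive.
HB.instance Definition _ :=
  GRing.isMonoidMorphism.Build A ore_ext oreC oreC_is_monoid_morphism.

Lemma oreX_prodE (m : seq 'I_n) : \prod_(i <- m) oreX i = << 1 *g m >>.
Proof.
elim: m => [|i m IHm]; first by rewrite big_nil.
by rewrite big_cons IHm ore_mulU /= oreZ1 oreT1.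
Qed.

Lemma oreC_mul_prodX c (m : seq 'I_n) :
  oreC c * \prod_(i <- m) oreX i = << c *g m >>.
Proof. by rewrite oreX_prodE ore_mulU /= oreZU mulr1. Qed.

Lemma ore_extE (f : ore_ext) :
  f = \sum_(m <- msupp f) oreC f@_m * \prod_(i <- m) oreX i.
Proof.
by rewrite [LHS](monalgE f); apply: eq_bigr => m _; rewrite oreC_mul_prodX.
Qed.

Lemma oreX_mulC i c : oreX i * oreC c =
  \sum_(j < n) oreC (sigma c i j) * oreX j + oreC (delta i c).
Proof.
rewrite ore_mulU /= oreZ1 oreTU; congr (_ + _); apply: eq_bigr => j _.
by rewrite ore_mulU /= oreZU mulr1.
Qed.

Section Evaluation.
Variable a : 'cV[A]_n.

Definition eval_ideal (f : ore_ext) : Prop :=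
  exists h : 'I_n -> ore_ext, f = \sum_(i < n) h i * (oreX i - oreC (a i 0)).

Definition pseudo_lin (i : 'I_n) (b : A) : A :=
  \sum_(j < n) sigma b i j * a j 0 + delta i b.

(* f(T_a), as a map from A to A *)
Definition ore_op (f : ore_ext) : A -> A :=
  fun b => \sum_(m <- msupp f) f@_m * foldr pseudo_lin b m.

Fact pseudo_lin_is_additive i : zmod_morphism (pseudo_lin i).
Proof.
move=> b c; rewrite /pseudo_lin !raddfB opprD addrACA; congr (_ + _).
by rewrite -sumrB; apply: eq_bigr => j _; rewrite !mxE mulrBl.
Qed.

Lemma pseudo_linM i c b : pseudo_lin i (c * b) =
  \sum_(j < n) sigma c i j * pseudo_lin j b + delta i c * b.
Proof.
rewrite /pseudo_lin sderM addrA rmorphM; congr (_ + _).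
under [RHS]eq_bigr => j _ do rewrite mulrDr mulr_sumr.
rewrite big_split /=; congr (_ + _); rewrite exchange_big /=.
apply: eq_bigr => j _; rewrite mxE mulr_suml.
by apply: eq_bigr => k _; rewrite mulrA.
Qed.

Let mulDl (b : A) : zmod_morphism (fun c => c * b).
Proof. by move=> c d; rewrite mulrBl. Qed.
Let mulDr (c : A) : zmod_morphism ( *%R c).
Proof. by move=> b d; rewrite mulrBr. Qed.

Lemma eval_idealD f g : eval_ideal f -> eval_ideal g -> eval_ideal (f + g).
Proof.
move=> [h ->] [k ->]; exists (fun i => h i + k i).
by rewrite -big_split; apply: eq_bigr => i _; rewrite mulrDl.
Qed.

Lemma eval_idealMl f g : eval_ideal g -> eval_ideal (f * g).
Proof.
move=> [h ->]; exists (fun i => f * h i); rewrite mulr_sumr.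
by apply: eq_bigr => i _; rewrite mulrA.
Qed.

Lemma eval_ideal0 : eval_ideal 0.
Proof. by exists (fun=> 0); rewrite big1 // => i _; rewrite mul0r. Qed.

Lemma eval_ideal_sum (I : Type) (r : seq I) (F : I -> ore_ext) :
  (forall i, eval_ideal (F i)) -> eval_ideal (\sum_(i <- r) F i).
Proof.
move=> hF; elim/big_ind: _ => //; [exact: eval_ideal0|exact: eval_idealD].
Qed.

Lemma eval_ideal_gen i : eval_ideal (oreX i - oreC (a i 0)).
Proof.
exists (fun j => (j == i)%:R); rewrite (bigD1 i) //= eqxx mul1r.
by rewrite big1 ?addr0 // => j /negPf ->; rewrite mul0r.
Qed.

Lemma eval_ideal_word (m : seq 'I_n) :
  exists b, eval_ideal (\prod_(i <- m) oreX i - oreC b).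
Proof.
elim: m => [|i m [b IHm]].
  by exists 1; rewrite big_nil rmorph1 subrr; apply: eval_ideal0.
exists (pseudo_lin i b); rewrite big_cons.
rewrite -(subrK (oreX i * oreC b) (_ * _)) -mulrBr -addrA.
apply: eval_idealD; first exact: eval_idealMl.
rewrite oreX_mulC /pseudo_lin raddfD opprD addrACA subrr addr0 raddf_sum.
rewrite -sumrB; apply: eval_ideal_sum => j.
by rewrite /= (rmorphM oreC) -mulrBr; apply/eval_idealMl/eval_ideal_gen.
Qed.

Lemma eval_ideal_op0 f : eval_ideal f -> ore_op f 1 = 0.
Proof.
have opD := formal_actDl pseudo_lin mulDl (1 : A).
pose op1 : {additive ore_ext -> A} := HB.pack (fun f : ore_ext => ore_op f 1)
  (GRing.isZmodMorphism.Build ore_ext A (fun f => ore_op f 1) opD).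
have opM g h : op1 (g * h) = ore_op g (op1 h).
  apply: formal_act_comp => //; [exact: pseudo_lin_is_additive| |].
  - by move=> c d v; rewrite mulrA.
  - exact: pseudo_linM.
have opU c m : op1 << c *g m >> = c * foldr pseudo_lin 1 m.
  exact: formal_actU.
have op0 g : ore_op g 0 = 0.
  rewrite /ore_op big1 // => m _.
  suff ->: foldr pseudo_lin 0 m = 0 by rewrite mulr0.
  elim: m => //= i m ->; rewrite -[X in pseudo_lin i X](subrr 0).
  by rewrite pseudo_lin_is_additive subrr.
move=> [h ->]; rewrite -[LHS]/(op1 _) raddf_sum big1 // => i _.
rewrite opM raddfB !opU /= mul1r mulr1 /pseudo_lin sder1 addr0 rmorph1.
rewrite (bigD1 i) //= big1 => [|j /negPf ij]; last by rewrite mxE eq_sym ij mul0r.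
by rewrite mxE eqxx mul1r addr0 subrr op0.
Qed.

Lemma eval_ideal_repr (f : ore_ext) :
  exists! b : A, eval_ideal (f - oreC b).
Proof.
have [b fb] : exists b, eval_ideal (f - oreC b).
  have [r hr] := boolp.choice eval_ideal_word.
  exists (\sum_(m <- msupp f) f@_m * r m).
  rewrite [X in X - _]ore_extE raddf_sum -sumrB.
  apply: eval_ideal_sum => m; rewrite /= (rmorphM oreC) -mulrBr.
  exact: eval_idealMl.
exists b; split=> // c fc; apply/eqP; rewrite -subr_eq0.
have: eval_ideal (oreC (b - c)).
  rewrite rmorphB -(subrKA f) addrC -[oreC b - f]opprB -[- (f - _)]mulN1r.
  by apply: eval_idealD => //; apply: eval_idealMl.
move/eval_ideal_op0; rewrite [ore_op _ _]formal_actU //= mulr1 => ->.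
by rewrite eqxx.
Qed.

(* f(a): the unique element of A representing f modulo eval_ideal *)
Definition ore_eval (f : ore_ext) : A := sval (cid (eval_ideal_repr f)).

End Evaluation.

End Actions.

Record unit_group (A : pzRingType) := UnitGroup {
  uval : A;
  uinv : A;
  uinvl : uinv * uval = 1;
  uinvr : uval * uinv = 1 }.

(* a^x = sigma(x) a x^-1 + delta(x) x^-1 *)
Definition ore_conj (A : pzRingType) (n : nat)
    (sigma : {rmorphism A -> 'M[A]_n}) (delta : sigma_derivation sigma)
    (a : 'cV[A]_n) (x : unit_group A) : 'cV[A]_n :=
  \col_i ((sigma (uval x) *m a) i 0 * uinv x + delta i (uval x) * uinv x).

(* Main.v *)
Require Import Defs.
From mathcomp Require Import all_boot all_algebra.
From mathcomp.classical Require Import boolp.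
Import GRing.Theory.
Local Open Scope ring_scope.

(** The map [b |-> f(T_a)(b)] makes [A] a left [S]-module in which the ideal
    defining evaluation at [a] kills [1]; hence [f(a) = f(T_a)(1)], and part (1)
    is associativity of the action. For part (2), right multiplication by a unit
    [u] intertwines [T_(a^u)] with [T_a]. *)

Section OreOp.
Context {A : pzRingType} {n : nat} {sigma : {rmorphism A -> 'M[A]_n}}.
Context {delta : sigma_derivation sigma}.
Implicit Types (f g : ore_ext delta) (a : 'cV[A]_n) (b c : A).

Let mulDl b : zmod_morphism (fun c => c * b).
Proof. by move=> c d; rewrite mulrBl. Qed.
Let mulDr c : zmod_morphism ( *%R c).
Proof. by move=> b d; rewrite mulrBr. Qed.

(** By [pseudo_linM], the maps [T_(a_i)] obey the commutation rule of the [t_i] with scalars, so the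
    action respects the product of [S]. *)
Lemma ore_opM a f g b : ore_op a (f * g) b = ore_op a f (ore_op a g b).
Proof.
apply: formal_act_comp => //; first exact: pseudo_lin_is_additive.
- by move=> c d v; rewrite mulrA.
- exact: pseudo_linM.
Qed.

Lemma ore_opBl a f g b : ore_op a (f - g) b = ore_op a f b - ore_op a g b.
Proof. exact: (formal_actDl (pseudo_lin delta a) mulDl b f g). Qed.

Lemma ore_opC a c b : ore_op a (oreC delta c) b = c * b.
Proof. exact: (formal_actU (pseudo_lin delta a) mulDl). Qed.

Lemma ore_evalE a f : ore_eval a f = ore_op a f 1.
Proof.
rewrite /ore_eval; case: cid => b [/= /eval_ideal_op0 + _].
by rewrite ore_opBl ore_opC mulr1 => /eqP; rewrite subr_eq0 => /eqP.
Qed.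

(** The product rule reduces this to [b = 1], where conjugation is made to give [T_a(u) = a^u u], by
    [u^-1 u = 1]. *)
Lemma pseudo_lin_conj a (u : unit_group A) i b :
  pseudo_lin delta a i (b * uval u) =
  pseudo_lin delta (ore_conj delta a u) i b * uval u.
Proof.
rewrite pseudo_linM /pseudo_lin mulrDl mulr_suml; congr (_ + _).
apply: eq_bigr => j _; rewrite -mulrA; congr (_ * _).
by rewrite !mxE -mulrDl -mulrA uinvl mulr1.
Qed.

(** Coefficients act on the left, so they commute with right multiplication by [u]; words follow
    letter by letter. *)
Lemma ore_op_conj a (u : unit_group A) f b :
  ore_op a f (b * uval u) = ore_op (ore_conj delta a u) f b * uval u.
Proof.
rewrite /ore_op mulr_suml; apply: eq_bigr => m _; rewrite -mulrA; congr (_ * _).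
by elim: m => //= i m ->; rewrite pseudo_lin_conj.
Qed.

End OreOp.

Theorem proposition4p4 (A : pzRingType) (n : nat) (hn : (0 < n)%N)
    (sigma : {rmorphism A -> 'M[A]_n}) (delta : sigma_derivation sigma)
    (f g : ore_ext delta) (a : 'cV[A]_n) (x : A) :
  (ore_eval a (f * g) = ore_op a f (ore_eval a g) /\
   ore_eval a (f * oreC delta x) = ore_op a f x) /\
  (forall u : unit_group A, ore_eval a g <> 0 -> uval u = ore_eval a g ->
     ore_eval a (f * g) = ore_eval (ore_conj delta a u) f * ore_eval a g).
Proof.
have evalM h : ore_eval a (f * h) = ore_op a f (ore_eval a h).
  by rewrite !ore_evalE ore_opM.
split; first by split; rewrite evalM // ore_evalE ore_opC mulr1.
(* Read [g(a)] as [1 * u], so that the intertwining applies at [b = 1]. *)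
by move=> u _ ug; rewrite evalM -ug ore_evalE -ore_op_conj mul1r.
Qed.
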